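(* Quantum auxiliary-input EFI pairs exist. That is, there exists a family $\{\xi_{\lambda,b}\}_{\lambda\in\mathbb{N},b\in\{0,1\}}$ of (mixed) quantum states such that: (i) for each $b\in\{0,1\}$, $\xi_{\lambda,b}$ is a $\mathrm{poly}(\lambda)$-qubit state; (ii) $\mathrm{TD}(\xi_{\lambda,0},\xi_{\lambda,1})=1-\mathsf{negl}(\lambda)$; (iii) for every non-uniform QPT distinguisher $\{\mathcal{A}_\lambda,\rho_\lambda\}_{\lambda\in\mathbb{N}}$, $$\left|\Pr[\mathcal{A}_\lambda(\rho_\lambda,\xi_{\lambda,0})=1]-\Pr[\mathcal{A}_\lambda(\rho_\lambda,\xi_{\lambda,1})=1]\right|=\mathsf{negl}(\lambda).$$
   Context: $\mathrm{TD}(\rho,\sigma)=\frac12\|\rho-\sigma\|_1$ is the trace distance. A non-uniform QPT algorithm $\{\mathcal{A}_\lambda,\rho_\lambda\}_{\lambda}$ consists of a $\mathrm{poly}(\lambda)$-size quantum circuit $\mathcal{A}_\lambda$ and an arbitrary $\mathrm{poly}(\lambda)$-qubit quantum advice state $\rho_\lambda$. The states $\xi_{\lambda,b}$ are not required to be efficiently generatable. *)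

(* Defs.v *)
From HB Require Import structures.
From mathcomp Require Import all_boot all_algebra.
From mathcomp Require Import Rstruct complex.
From Stdlib Require Rdefinitions.

Set Implicit Arguments.
Unset Strict Implicit.
Unset Printing Implicit Defensive.
Import GRing.Theory Num.Theory.
Local Open Scope ring_scope.

Definition Real := Rdefinitions.R.
Definition Cx := complex Real.

Definition bits (n : nat) := {ffun 'I_n -> bool}.

(** Linear operators on the 2^n-dimensional Hilbert space of n qubits,
    as matrices indexed by computational-basis states. *)
Definition Op (n : nat) := bits n -> bits n -> Cx.

Definition opadd n (A B : Op n) : Op n := fun x y => A x y + B x y.
Definition opsub n (A B : Op n) : Op n := fun x y => A x y - B x y.
Definition opmul n (A B : Op n) : Op n :=
  fun x y => \sum_(k : bits n) A x k * B k y.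
Definition adjoint n (A : Op n) : Op n := fun x y => (A y x)^*.
Definition trace n (A : Op n) : Cx := \sum_(x : bits n) A x x.

Definition psd n (A : Op n) : Prop :=
  forall v : bits n -> Cx,
    0 <= \sum_(x : bits n) \sum_(y : bits n) (v x)^* * A x y * v y.

Definition density n (rho : Op n) : Prop := psd rho /\ trace rho = 1.

(** [is_trace_norm A t] : ||A||_1 = Tr sqrt(A^dagger A) = t, where sqrt is the
    (unique) positive semidefinite square root. *)
Definition is_trace_norm n (A : Op n) (t : Real) : Prop :=
  exists B : Op n, psd B /\ opmul B B = opmul (adjoint A) A /\ trace B = (t%:C)%C.

Definition is_trace_distance n (rho sigma : Op n) (d : Real) : Prop :=
  is_trace_norm (opsub rho sigma) (2 * d).

Definition negligible (eps : nat -> Real) : Prop :=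
  forall c : nat, exists N : nat, forall lam : nat, (N <= lam)%N ->
    `|eps lam| * (lam%:R) ^+ c <= 1.

Definition poly_bounded (f : nat -> nat) : Prop :=
  exists c : nat, forall lam : nat, (f lam <= lam ^ c + c)%N.

Inductive gate (N : nat) : Type :=
| GH of 'I_N
| GT of 'I_N
| GCNOT of 'I_N & 'I_N.   (* control, target *)

Definition invsqrt2 : Cx := (((Num.sqrt (2 : Real))^-1)%:C)%C.
Definition omega8 : Cx := ((Num.sqrt (2 : Real))^-1 +i* (Num.sqrt (2 : Real))^-1)%C.

Definition H1 (a b : bool) : Cx := if a && b then - invsqrt2 else invsqrt2.
Definition T1 (a b : bool) : Cx := if a == b then (if a then omega8 else 1) else 0.

Definition agree_off N (S : pred 'I_N) (x y : bits N) : bool :=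
  [forall k, (k \notin S) ==> (x k == y k)].

Definition gate_op N (g : gate N) : Op N :=
  match g with
  | GH i => fun x y => if agree_off (pred1 i) x y then H1 (x i) (y i) else 0
  | GT i => fun x y => if agree_off (pred1 i) x y then T1 (x i) (y i) else 0
  | GCNOT c t => fun x y =>
      if c == t then (if x == y then 1 else 0)
      else if agree_off (pred2 c t) x y && (x c == y c)
                && (x t == (y t (+) y c))
           then 1 else 0
  end.

Definition run_circuit N (C : seq (gate N)) (rho : Op N) : Op N :=
  foldl (fun r g => opmul (opmul (gate_op g) r) (adjoint (gate_op g))) rho C.

(** Total register: advice (a qubits) ++ input (n qubits) ++ work (m+1 qubits,
    initialised to |0>); the first work qubit is the output qubit. *)
Definition total_qubits (a n m : nat) := (a + (n + m.+1))%N.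

Definition adv_part a n m (x : bits (total_qubits a n m)) : bits a :=
  [ffun i => x (lshift (n + m.+1) i)].
Definition inp_part a n m (x : bits (total_qubits a n m)) : bits n :=
  [ffun i => x (rshift a (lshift m.+1 i))].
Definition wrk_part a n m (x : bits (total_qubits a n m)) : bits m.+1 :=
  [ffun i => x (rshift a (rshift n i))].
Definition out_qubit a n m : 'I_(total_qubits a n m) := rshift a (rshift n ord0).

(** rho (x) xi (x) |0..0><0..0| *)
Definition initial_state a n m (rho : Op a) (xi : Op n) : Op (total_qubits a n m) :=
  fun x y => rho (adv_part x) (adv_part y) * xi (inp_part x) (inp_part y)
             * (if [forall i, ~~ wrk_part x i] && [forall i, ~~ wrk_part y i]
                then 1 else 0).

(** Pr[A(rho, xi) = 1]: run the circuit, measure the output qubit in the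
    computational basis. *)
Definition accept_prob a n m (C : seq (gate (total_qubits a n m)))
    (rho : Op a) (xi : Op n) : Real :=
  complex.Re (\sum_(x : bits (total_qubits a n m) | x (out_qubit a n m))
               run_circuit C (@initial_state a n m rho xi) x x).

Record nu_qpt (n : nat -> nat) := NuQPT {
  adv_qubits : nat -> nat;
  work_qubits : nat -> nat;
  circuit : forall lam, seq (gate (total_qubits (adv_qubits lam) (n lam) (work_qubits lam)));
  advice : forall lam, Op (adv_qubits lam)
}.

Arguments advice {n} _ _.

Definition nu_qpt_valid n (A : nu_qpt n) : Prop :=
  (forall lam, density (advice A lam)) /\
  poly_bounded (fun lam => adv_qubits A lam + work_qubits A lam + size (circuit A lam))%N.

Definition run_nu_qpt n (A : nu_qpt n) (lam : nat) (xi : Op (n lam)) : Real :=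
  accept_prob (circuit A lam) (advice A lam) xi.

(* Main.v *)
Require Import Defs.
From HB Require Import structures.
From mathcomp Require Import all_boot all_order all_algebra ring zify.
From mathcomp Require Import Rstruct complex.
From Stdlib Require Import FunctionalExtensionality ClassicalEpsilon.
Import Order.TTheory GRing.Theory Num.Theory.
Local Open Scope ring_scope.
Set Implicit Arguments.
Unset Strict Implicit.
Unset Printing Implicit Defensive.

(** Fix signs [e : bits k -> bool] and let [xi_b] be uniform over the strings
    [(e t (+) b, t)].  The two supports partition [bits k.+1], so the trace
    distance is exactly 1.  A circuit accepts [(rho, xi)] with probability
    [sum_z xi(z) Tr (X_z rho)], where the [X_z] are Hermitian contractions on the
    advice register, so its advantage is [2^(1-k) Tr (Z_e rho)] with
    [Z_e = sum_t (-1)^(e t) Y_t] and [Y_t] half a difference of two of the [X_z].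
    To treat all advice states at once, one bounds [Z_e] itself: by repeated
    Cauchy-Schwarz [Tr (Z rho)^(2q) <= Tr (Z^(2q))] when [q] is a power of two,
    and the average over [e] of [Tr (Z_e^(2q))] is at most
    [dim * K^q * q^(2q)], [K = 2^k], since only the words in which every letter
    occurs an even number of times survive.  For [q = 2^(2 lam + 4)] the factor
    [2^q] absorbs both the dimension and the number of circuits of size at most
    [2^lam], so some [e] is good against all of them at once. *)

(** * Contractions, Hermitian matrices and density matrices *)

Section Contractions.
Variable C : numClosedFieldType.

Definition adjmx m n (A : 'M[C]_(m, n)) : 'M[C]_(n, m) :=
  (map_mx Num.conj A)^T.

Definition hermitian n (A : 'M[C]_n) := adjmx A = A.

(** The squared Hilbert-Schmidt norm; on column vectors it is the squared Euclidean norm. *)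
Definition normsq m n (A : 'M[C]_(m, n)) : C := \tr (adjmx A *m A).

(** Operator norm at most 1, phrased through vectors so that no singular values are needed. *)
Definition contraction m n (A : 'M[C]_(m, n)) :=
  forall v : 'cV[C]_n, normsq (A *m v) <= normsq v.

Lemma adjmxE m n (A : 'M[C]_(m, n)) i j : adjmx A i j = (A j i)^*.
Proof. by rewrite !mxE. Qed.

Lemma adjmxK m n (A : 'M[C]_(m, n)) : adjmx (adjmx A) = A.
Proof. by apply/matrixP => i j; rewrite !adjmxE conjCK. Qed.

Lemma adjmxM m n p (A : 'M[C]_(m, n)) (B : 'M[C]_(n, p)) :
  adjmx (A *m B) = adjmx B *m adjmx A.
Proof. by rewrite /adjmx map_mxM trmx_mul. Qed.

Lemma adjmxD m n (A B : 'M[C]_(m, n)) : adjmx (A + B) = adjmx A + adjmx B.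
Proof. by rewrite /adjmx map_mxD linearD. Qed.

Lemma adjmxB m n (A B : 'M[C]_(m, n)) : adjmx (A - B) = adjmx A - adjmx B.
Proof. by rewrite /adjmx map_mxB linearB. Qed.

Lemma adjmxZ m n c (A : 'M[C]_(m, n)) : adjmx (c *: A) = c^* *: adjmx A.
Proof. by rewrite /adjmx map_mxZ linearZ. Qed.

Lemma adjmx_sum m n (I : finType) (F : I -> 'M[C]_(m, n)) :
  adjmx (\sum_i F i) = \sum_i adjmx (F i).
Proof. by rewrite /adjmx map_mx_sum linear_sum. Qed.

Lemma mxtrace_adj n (A : 'M[C]_n) : \tr (adjmx A) = (\tr A)^*.
Proof. by rewrite /mxtrace rmorph_sum; apply: eq_bigr => i _; rewrite adjmxE. Qed.

Lemma normsqE m n (A : 'M[C]_(m, n)) :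
  normsq A = \sum_i \sum_j `|A i j| ^+ 2.
Proof.
rewrite exchange_big /normsq /mxtrace; apply: eq_bigr => j _ /=.
by rewrite mxE; apply: eq_bigr => i _; rewrite adjmxE normCKC.
Qed.

Lemma normsq_ge0 m n (A : 'M[C]_(m, n)) : 0 <= normsq A.
Proof.
by rewrite normsqE; apply: sumr_ge0 => i _; apply: sumr_ge0 => j _; rewrite exprn_ge0.
Qed.

Lemma contractionM m n p (A : 'M[C]_(m, n)) (B : 'M[C]_(n, p)) :
  contraction A -> contraction B -> contraction (A *m B).
Proof. by move=> cA cB v; rewrite -mulmxA (le_trans (cA _)). Qed.

Lemma contraction1 n : contraction (1%:M : 'M[C]_n).
Proof. by move=> v; rewrite mul1mx. Qed.

(* Expand [0 <= ||v - A A^* v||^2]. *)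
Lemma contraction_adj m n (A : 'M[C]_(m, n)) :
  contraction A -> contraction (adjmx A).
Proof.
move=> cA v; set w := adjmx A *m v.
have := normsq_ge0 (v - A *m w).
have e : \tr (adjmx v *m (A *m w)) = normsq w.
  by rewrite /normsq {2}/w adjmxM adjmxK mulmxA.
have e' : \tr (adjmx (A *m w) *m v) = normsq w.
  by rewrite adjmxM -mulmxA.
rewrite {1}/normsq adjmxB mulmxBl !mulmxBr !raddfB /= e e' => h0.
have h1 := cA w; rewrite -[\tr (_ *m (A *m w))]/(normsq (A *m w)) in h0.
rewrite -subr_ge0 in h1; rewrite -subr_ge0.
by have := addr_ge0 h0 h1; congr (_ <= _); rewrite /normsq; ring.
Qed.

(** Parallelogram law, entry by entry: [|a - b|^2 <= 2 (|a|^2 + |b|^2)]. *)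
Lemma contraction_half_sub m n (A B : 'M[C]_(m, n)) :
  contraction A -> contraction B -> contraction (2^-1 *: (A - B)).
Proof.
move=> cA cB v; rewrite -scalemxAl mulmxBl.
apply: (@le_trans _ _ (2^-1 * (normsq (A *m v) + normsq (B *m v)))); last first.
  rewrite ler_pdivrMl ?ltr0n // mulr_natl mulr2n; exact: lerD.
move: (A *m v) (B *m v) => a b.
rewrite !normsqE -big_split mulr_sumr /=; apply: ler_sum => i _.
rewrite -big_split mulr_sumr /=; apply: ler_sum => j _.
rewrite !mxE normrM exprMn.
have -> : `|2^-1 : C| ^+ 2 = 2^-1 * 2^-1 by rewrite ger0_norm ?invr_ge0 ?ler0n // expr2.
rewrite -mulrA ler_wpM2l ?invr_ge0 ?ler0n // ler_pdivrMl ?ltr0n //.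
rewrite -subr_ge0.
have -> : 2 * (`|a i j| ^+ 2 + `|b i j| ^+ 2) - `|a i j - b i j| ^+ 2 =
          `|a i j + b i j| ^+ 2.
  by rewrite !normCK !rmorphD !rmorphN /=; ring.
by rewrite exprn_ge0.
Qed.

(** Each diagonal entry is a coordinate of the image of a unit vector, so it has modulus at most
    1. *)
Lemma contraction_trace n (A : 'M[C]_n) : contraction A -> `|\tr A| <= n%:R.
Proof.
move=> cA; rewrite /mxtrace (le_trans (ler_norm_sum _ _ _)) //.
rewrite -[n in n%:R]card_ord -sum1_card natr_sum; apply: ler_sum => i _.
rewrite -(@expr_le1 _ 2) //; have := cA (delta_mx i 0).
rewrite -colE !normsqE (bigD1 i) //= big_ord1 mxE => h.
have le0 : forall x y : C, 0 <= y -> x <= x + y by move=> x y; rewrite lerDl.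
apply: le_trans (le_trans (le0 _ _ _) h) _.
  by apply: sumr_ge0 => k _; apply: sumr_ge0 => j _; rewrite exprn_ge0.
rewrite (bigD1 i) //= big_ord1 mxE !eqxx normr1 expr1n big1 ?addr0 //.
by move=> k ki; rewrite big_ord1 mxE (negPf ki) normr0 expr0n.
Qed.

Lemma contraction_prod n (I : finType) (F : I -> 'M[C]_n) :
  (forall i, contraction (F i)) -> contraction (\prod_i F i).
Proof.
move=> cF; apply: (big_ind (fun A => contraction A)) => //.
- exact: contraction1.
- by move=> A B; apply: contractionM.
Qed.

Lemma hermitianX n (A : 'M[C]_n) k : hermitian A -> hermitian (A ^+ k).
Proof.
move=> hA; elim: k => [|k IH].
  by rewrite /hermitian; apply/matrixP => i j; rewrite adjmxE !mxE eq_sym conjC_nat.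
by rewrite /hermitian exprSr [LHS]adjmxM IH hA -[LHS]exprS exprSr.
Qed.

Lemma hermitian_sumZ n (I : finType) (c : I -> C) (F : I -> 'M[C]_n) :
  (forall i, c i \is Num.real) -> (forall i, hermitian (F i)) ->
  hermitian (\sum_i c i *: F i).
Proof.
move=> rc hF; rewrite /hermitian adjmx_sum; apply: eq_bigr => i _.
by rewrite adjmxZ hF conj_Creal.
Qed.

Lemma hermitian_trace_sqr_ge0 n (A : 'M[C]_n) : hermitian A -> 0 <= \tr (A ^+ 2).
Proof. by move=> hA; rewrite expr2; have := normsq_ge0 A; rewrite /normsq hA. Qed.

Definition psdmx n (A : 'M[C]_n) :=
  forall v : 'cV[C]_n, 0 <= \tr (adjmx v *m A *m v).

(** The quadratic form at [s e_i + t e_j]; suitable [s] and [t] yield the facts on positive matrices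
    below. *)
Lemma psdmx_two_coords n (A : 'M[C]_n) i j (s t : C) : psdmx A ->
  0 <= s^* * s * A i i + s^* * t * A i j + t^* * s * A j i + t^* * t * A j j.
Proof.
move=> /(_ (s *: delta_mx i 0 + t *: delta_mx j 0)).
have E (k l : 'I_n) : \tr (adjmx (delta_mx k 0 : 'cV[C]_n) *m A *m delta_mx l 0) = A k l.
  have -> : adjmx (delta_mx k 0 : 'cV[C]_n) = delta_mx 0 k.
    by apply/matrixP => a b; rewrite adjmxE !mxE conjC_nat andbC.
  by rewrite -rowE -colE /mxtrace big_ord1 !mxE.
rewrite adjmxD !adjmxZ !mulmxDl !mulmxDr -!scalemxAl -!scalemxAr !scalerA
   !mxtraceD !mxtraceZ !E.
by congr (_ <= _); ring.
Qed.

(** Polarization: the form and its diagonal terms are real, hence so are the cross terms. Taking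
    [(s, t) = (1, 1)] and [(1, 'i)] makes [A i j + A j i] and ['i (A i j - A j i)] real. *)
Lemma psdmx_hermitian n (A : 'M[C]_n) : psdmx A -> hermitian A.
Proof.
move=> pA; apply/matrixP => j i; rewrite adjmxE.
have dr k : A k k \is Num.real.
  have := psdmx_two_coords k k 1 0 pA.
  by rewrite conjC1 conjC0 !(mul1r, mulr1, mul0r, addr0) => /ger0_real.
have cross s t : (s^* * t * A i j + t^* * s * A j i) \is Num.real.
  have sr (z : C) : z^* * z \is Num.real by rewrite -normCKC realX // normr_real.
  set z := (X in X \is _).
  have -> : z = s^* * s * A i i + s^* * t * A i j + t^* * s * A j i + t^* * t * A j j
      - s^* * s * A i i - t^* * t * A j j by rewrite /z; ring.
  apply: rpredB; last exact: rpredM.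
  by apply: rpredB; [apply: ger0_real; apply: psdmx_two_coords | apply: rpredM].
have /CrealP := cross 1 1; have /CrealP := cross 1 'i.
rewrite !(rmorphD, rmorphM, rmorphN) /= !(conjC1, conjCi, conjCK, mul1r, mulr1).
rewrite !(rmorphD, rmorphM, rmorphN) /= !(conjC1, conjCi, conjCK, mul1r, mulr1).
set a := A i j; set b := A j i => h1 h2.
have i0 : ('i : C) != 0 by exact: neq0Ci.
apply: (mulfI i0); apply: (@mulfI _ 2); rewrite ?pnatr_eq0 //.
have -> : 2 * ('i * a^*) = 'i * (a^* + b^*) - (- 'i * a^* + - - 'i * b^*) by ring.
by rewrite h1 h2; ring.
Qed.

Lemma psdmx_diag_ge0 n (A : 'M[C]_n) i : psdmx A -> 0 <= A i i.
Proof.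
move=> pA; have := psdmx_two_coords i i 1 0 pA.
by rewrite conjC1 conjC0 !(mul1r, mulr1, mul0r, addr0).
Qed.

Lemma psdmx_minor n (A : 'M[C]_n) i j : psdmx A ->
  `|A i j| ^+ 2 <= A i i * A j j.
Proof.
move=> pA; have hA := psdmx_hermitian pA.
have cA k l : (A k l)^* = A l k by rewrite -adjmxE hA.
have di := psdmx_diag_ge0 i pA; have dj := psdmx_diag_ge0 j pA.
have [j0|j0] := eqVneq (A j j) 0.
  (* With [A j j = 0] this test vector gives [- (A i i + 2) |A i j|^2 >= 0], which forces the entry
     to vanish. *)
  have := psdmx_two_coords i j (- A i j) (A i i + 1) pA.
  rewrite j0 !mulr0 addr0 rmorphN rmorphD /= conjC1 !cA.
  have -> : - A j i * - A i j * A i i + - A j i * (A i i + 1) * A i j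
     + (A i i + 1) * - A i j * A j i = - ((A i i + 2) * (A i j * A j i)) by ring.
  rewrite normCK cA oppr_ge0 pmulr_rle0 //.
  by rewrite ltr_wpDl.
have := psdmx_two_coords i j (A j j) (- A j i) pA.
rewrite rmorphN /= !cA.
have -> : A j j * A j j * A i i + A j j * - A j i * A i j + - A i j * A j j * A j i
   + - A i j * - A j i * A j j = A j j * (A i i * A j j - A i j * A j i) by ring.
by rewrite pmulr_rge0 ?lt0r ?j0 // subr_ge0 normCK cA.
Qed.

(** Sum the 2 x 2 minor inequalities: the left side is the sum of all [|A i j|^2], the right side is
    [(\tr A)^2]. *)
Lemma density_purity n (A : 'M[C]_n) : psdmx A -> \tr A = 1 -> \tr (A ^+ 2) <= 1.
Proof.
move=> pA tA; rewrite -[leRHS](expr1n _ 2) -tA expr2.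
have := erefl (normsq A); rewrite {1}/normsq (psdmx_hermitian pA) => ->.
rewrite normsqE expr2 /mxtrace mulr_suml; apply: ler_sum => i _.
by rewrite mulr_sumr; apply: ler_sum => j _; apply: psdmx_minor.
Qed.

(** * Trace inequalities against a density matrix *)

Section Jensen.
Variables (n : nat) (rho : 'M[C]_n).
Hypotheses (psd_rho : psdmx rho) (tr_rho : \tr rho = 1).

Lemma trace_density_real (A : 'M[C]_n) : hermitian A -> \tr (A *m rho) \is Num.real.
Proof.
move=> hA; apply/CrealP.
by rewrite -mxtrace_adj adjmxM hA (psdmx_hermitian psd_rho) mxtrace_mulC.
Qed.

(** Nonnegativity of the variance [\tr ((A - c)^2 rho)], where [c] is the mean [\tr (A rho)]. *)
Lemma trace_density_sqr (A : 'M[C]_n) : hermitian A ->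
  \tr (A *m rho) ^+ 2 <= \tr (A ^+ 2 *m rho).
Proof.
move=> hA; have rc := trace_density_real hA; set c := \tr (A *m rho) in rc *.
set B := A - c%:M.
have hB : hermitian B.
  rewrite /hermitian adjmxB hA; congr (_ - _); apply/matrixP => i j.
  by rewrite adjmxE !mxE rmorphMn /= (conj_Creal rc) eq_sym.
have : 0 <= \tr (B *m B *m rho).
  rewrite -mulmxA mxtrace_mulC /mxtrace; apply: sumr_ge0 => i _.
  have := psd_rho (col i B); rewrite /mxtrace big_ord1; congr (_ <= _).
  rewrite mxE [RHS]mxE; apply: eq_bigr => j _; rewrite [col i B j _]mxE.
  congr (_ * _); rewrite !mxE; apply: eq_bigr => k _.
  by rewrite adjmxE mxE -adjmxE hB.
have -> : B *m B *m rho =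
    A *m A *m rho - (c *: (A *m rho) + c *: (A *m rho) - (c * c) *: rho).
  rewrite /B mulmxBl !mulmxBr !mulmxBl !mul_mx_scalar -!scalemxAl
    !mul_scalar_mx -!scalemxAl scalerA.
  by rewrite !opprB !addrA opprD addrA [X in X - _ = _]addrAC.
rewrite !raddfB !raddfD /= raddfN /= !mxtraceZ tr_rho -/c mulr1 addrK subr_ge0.
by rewrite -expr2.
Qed.

(** Cauchy-Schwarz for the Hilbert-Schmidt product: expand [\tr ((A - c rho)^2) >= 0] and use that
    [\tr (rho^2) <= 1]. This is the step that eliminates [rho]. *)
Lemma trace_density_le_purity (A : 'M[C]_n) : hermitian A ->
  \tr (A *m rho) ^+ 2 <= \tr (A ^+ 2).
Proof.
move=> hA; have rc := trace_density_real hA; set c := \tr (A *m rho) in rc *.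
set B := A - c *: rho.
have hB : hermitian B.
  by rewrite /hermitian adjmxB adjmxZ hA (conj_Creal rc) (psdmx_hermitian psd_rho).
have := hermitian_trace_sqr_ge0 hB.
rewrite expr2 -[_ * _]/(_ *m _) mulmxBl !mulmxBr -!scalemxAl -!scalemxAr.
rewrite !raddfB /= !mxtraceZ [\tr (rho *m A)]mxtrace_mulC -/c => h.
have := density_purity psd_rho tr_rho; rewrite expr2 -[_ * _]/(_ *m _) -subr_ge0 => h1.
have c2 : 0 <= c ^+ 2 by rewrite -realEsqr.
rewrite expr2 -[X in _ <= \tr X]/(_ *m _) -subr_ge0.
by have := addr_ge0 h (mulr_ge0 c2 h1); congr (_ <= _); ring.
Qed.

(** Each induction step squares [A], hence the exponents that are powers of two; the base case
    removes [rho]. *)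
Lemma trace_density_pow (A : 'M[C]_n) j : hermitian A ->
  \tr (A *m rho) ^+ (2 ^ j.+1) <= \tr (A ^+ (2 ^ j.+1)).
Proof.
elim: j A => [|j IH] A hA; first exact: trace_density_le_purity.
have h2 := trace_density_sqr hA.
rewrite [(2 ^ j.+2)%N]expnS !exprM; apply: le_trans (IH _ (hermitianX 2 hA)).
apply: lerXn2r => //; rewrite nnegrE.
  by rewrite -realEsqr trace_density_real.
by apply: le_trans h2; rewrite -realEsqr trace_density_real.
Qed.

End Jensen.
End Contractions.

(** * Moments of random signed sums *)

Section Moments.
Variables (C : numClosedFieldType) (T : finType).

Definition signed_sum d (e : {ffun T -> bool}) (Y : T -> 'M[C]_d) :=
  \sum_t (-1) ^+ e t *: Y t.

Definition letter_even p (w : {ffun 'I_p -> T}) :=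
  [forall t, ~~ odd #|[set j | w j == t]|].

Lemma signed_sum_pow d p e (Y : T -> 'M[C]_d) :
  signed_sum e Y ^+ p =
  \sum_(w : {ffun 'I_p -> T}) (\prod_j (-1) ^+ e (w j)) *: \prod_j Y (w j).
Proof.
rewrite -[p in LHS]card_ord -prodr_const bigA_distr_bigA /=.
apply: eq_bigr => w _.
elim/big_rec3: _ => [|j A c B _ ->]; first by rewrite scale1r.
by rewrite -[_ * _ in LHS]/(_ *m _) -scalemxAl -scalemxAr scalerA.
Qed.

(** Flipping the sign of a letter with odd multiplicity is an involution on [e] that negates every
    product, so the sum equals its own opposite. *)
Lemma sum_signs_eq0 p (w : {ffun 'I_p -> T}) : ~~ letter_even w ->
  \sum_(e : {ffun T -> bool}) \prod_j (-1) ^+ e (w j) = 0 :> C.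
Proof.
move=> /forallPn[t]; rewrite negbK => todd.
pose flip (e : {ffun T -> bool}) : {ffun T -> bool} := [ffun x => e x (+) (x == t)].
have flipK : involutive flip.
  by move=> e; apply/ffunP => x; rewrite !ffunE -addbA addbb addbF.
set S := LHS.
have : S = - S.
  rewrite {1}/S (reindex_inj (inv_inj flipK)) -sumrN; apply: eq_bigr => e _.
  under eq_bigr => j _ do rewrite ffunE signr_addb.
  rewrite big_split /= -[RHS]mulrN1; congr (_ * _).
  rewrite -(big_morph _ (exprD (-1)) (expr0 _)).
  rewrite -signr_odd (_ : \sum_(j < p) _ = #|[set j | w j == t]|)%N; first by rewrite todd.
by rewrite -sum1_card [RHS]big_mkcond; apply: eq_bigr => j _; rewrite inE; case: eqP.
by move/eqP; rewrite -addr_eq0 -mulr2n mulrn_eq0 /= => /eqP.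
Qed.

(** A letter that occurs at all occurs at least twice. *)
Lemma letter_even_codom k (w : {ffun 'I_(2 * k) -> T}) :
  letter_even w -> (#|[set w j | j : 'I_(2 * k)]| <= k)%N.
Proof.
move=> /forallP ev; rewrite -(leq_pmul2l (ltn0Sn 1)).
rewrite -[leqRHS]card_ord -[leqRHS]sum1_card.
rewrite (partition_big w (mem [set w j | j : 'I_(2 * k)])) /=; last first.
  by move=> j _; apply: imset_f.
rewrite mulnC -sum_nat_const; apply: leq_sum => t /imsetP[j _ wj].
rewrite sum1_card; have := ev t.
have -> : #|[set j | w j == t]| = #|[pred i | w i == t]|
  by apply: eq_card => i; rewrite !inE.
have : (0 < #|[pred i | w i == t]|)%N by apply/card_gt0P; exists j; rewrite inE wj.
by case: (#|_|) => [|[|]].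
Qed.

(** A word with at most [k] distinct letters factors through ['I_k]: choose a list of [k] letters,
    then for each position an index into it. *)
Lemma card_letter_even k : (0 < k)%N ->
  (#|[set w : {ffun 'I_(2 * k) -> T} | letter_even w]| <= #|T| ^ k * k ^ (2 * k))%N.
Proof.
move=> k0; have j0 : 'I_(2 * k) by apply: (@Ordinal _ 0); rewrite muln_gt0.
pose comp (gh : {ffun 'I_k -> T} * {ffun 'I_(2 * k) -> 'I_k}) :=
  [ffun j => gh.1 (gh.2 j)] : {ffun 'I_(2 * k) -> T}.
have -> : (#|T| ^ k * k ^ (2 * k) =
    #|{: {ffun 'I_k -> T} * {ffun 'I_(2 * k) -> 'I_k}}|)%N.
  by rewrite card_prod !card_ffun !card_ord.
apply: leq_trans (leq_imset_card comp _); apply: subset_leq_card.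
apply/subsetP => w; rewrite inE => /letter_even_codom.
rewrite cardE; set s := enum _ => ss.
have ws j : w j \in s by rewrite mem_enum imset_f.
have lt j : (index (w j) s < k)%N by apply: leq_trans ss; rewrite index_mem.
(* The default letter [w j0] pads the list when fewer than [k] letters occur. *)
apply/imsetP; exists ([ffun i : 'I_k => nth (w j0) s i], [ffun j => Ordinal (lt j)]) => //.
by apply/ffunP => j; rewrite !ffunE /= nth_index.
Qed.

Lemma sum_signs_le p (w : {ffun 'I_p -> T}) :
  `|\sum_(e : {ffun T -> bool}) \prod_j (-1) ^+ e (w j) : C| <=
  if letter_even w then (2 ^ #|T|)%:R else 0.
Proof.
case: ifPn => [_|/sum_signs_eq0 ->]; last by rewrite normr0.
rewrite (le_trans (ler_norm_sum _ _ _)) //.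
have -> : (2 ^ #|T|)%N = #|{ffun T -> bool}| by rewrite card_ffun card_bool.
rewrite -sum1_card natr_sum; apply: ler_sum => e _.
by rewrite normr_prod big1 // => j _; rewrite normr_sign.
Qed.

(* Averaging over the signs kills every word in which some letter occurs an
   odd number of times. *)
Lemma sum_trace_signed_sum d (Y : T -> 'M[C]_d) k : (0 < k)%N ->
  (forall t, contraction (Y t)) ->
  `|\sum_(e : {ffun T -> bool}) \tr (signed_sum e Y ^+ (2 * k))| <=
  (2 ^ #|T| * (#|T| ^ k * k ^ (2 * k)) * d)%:R.
Proof.
move=> k0 cY.
under eq_bigr => e _ do rewrite signed_sum_pow raddf_sum /=.
rewrite exchange_big /=.
apply: (@le_trans _ _ (\sum_(w | letter_even w) ((2 ^ #|T|) * d)%:R : C)); last first.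
  rewrite sumr_const -mulrnA ler_nat mulnAC leq_mul2r.
  apply/orP; right; rewrite leq_mul2l; apply/orP; right.
  apply: leq_trans (card_letter_even k0); apply: eq_leq.
  by apply: eq_card => w; rewrite !inE.
rewrite [leRHS]big_mkcond (le_trans (ler_norm_sum _ _ _)) //; apply: ler_sum => w _.
under eq_bigr => e _ do rewrite mxtraceZ.
rewrite -mulr_suml normrM.
have h := contraction_trace (contraction_prod (fun j => cY (w j))).
have := sum_signs_le w; case: ifP => _ h'.
  by rewrite natrM; apply: ler_pM.
by rewrite (le_anti (introT andP (conj h' (normr_ge0 _)))) mul0r.
Qed.

(** First moment method. The traces are nonnegative, being those of even powers of Hermitian
    matrices, so one [e] whose sum over [J] is at most the average bounds every [j] at once, at the
    cost of a factor [#|J|]. *)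
Lemma exists_signs (J : finType) (d : J -> nat) D (Y : forall j, T -> 'M[C]_(d j)) k :
  (0 < k)%N -> (forall j, d j <= D)%N ->
  (forall j t, contraction (Y j t)) -> (forall j t, hermitian (Y j t)) ->
  exists e, forall j, \tr (signed_sum e (Y j) ^+ (2 * k)) <=
     (#|J| * D * (#|T| ^ k * k ^ (2 * k)))%:R.
Proof.
move=> k0 dD cY hY.
pose F e j := \tr (signed_sum e (Y j) ^+ (2 * k)).
have F0 e j : 0 <= F e j.
  rewrite /F mulnC exprM; apply: hermitian_trace_sqr_ge0; apply: hermitianX.
  by apply: hermitian_sumZ => // t; rewrite rpredX // rpredN rpred1.
set B := (X in X%:R).
suff [e he] : exists e, \sum_j F e j <= B%:R.
  exists e => j; apply: le_trans he; rewrite (bigD1 j) //= lerDl.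
  exact: sumr_ge0.
have tot : \sum_(e : {ffun T -> bool}) \sum_j F e j <= (2 ^ #|T|)%:R * B%:R.
  rewrite exchange_big /= /B -natrM mulnA mulnA [(2 ^ _ * _)%N]mulnC -!mulnA natrM.
  rewrite mulr_natl -sumr_const; apply: ler_sum => j _.
  rewrite -[leLHS]ger0_norm ?sumr_ge0 //.
  apply: le_trans (sum_trace_signed_sum k0 (cY j)) _.
  by rewrite ler_nat mulnC leq_mul.
case: (pickP (fun e => \sum_j F e j <= B%:R)) => [e he|no]; first by exists e.
(* If no [e] worked, summing these strict inequalities over all [e] would contradict [tot]. *)
have lt e : B%:R < \sum_j F e j.
  by rewrite real_ltNge ?no ?realn // ger0_real ?sumr_ge0.
move: tot.
rewrite real_leNgt ?ger0_real ?mulr_ge0 ?sumr_ge0 // => [|e _]; last exact: sumr_ge0.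
have -> : (2 ^ #|T|)%N = #|{ffun T -> bool}| by rewrite card_ffun card_bool.
rewrite mulr_natl -sumr_const ltr_sum //.
by apply/hasP; exists [ffun=> false]; rewrite ?mem_index_enum.
Qed.

End Moments.

(** * Circuits as contractions *)

Section FinTypeMatrices.
Variable C : numClosedFieldType.

(** Passes from operators indexed by bit strings to ordinal-indexed matrices; two index types allow
    maps between different registers. *)
Definition fmx (I J : finType) (A : I -> J -> C) : 'M[C]_(#|I|, #|J|) :=
  \matrix_(i, j) A (enum_val i) (enum_val j).

Lemma sum_enum_val (I : finType) (V : nmodType) (F : I -> V) :
  \sum_(i < #|I|) F (enum_val i) = \sum_x F x.
Proof. by rewrite [RHS](reindex _ (onW_bij _ (enum_val_bij I))). Qed.

Lemma fmxM (I J K : finType) (A : I -> J -> C) (B : J -> K -> C) :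
  fmx A *m fmx B = fmx (fun x z => \sum_y A x y * B y z).
Proof.
apply/matrixP => i k; rewrite !mxE -[RHS]sum_enum_val.
by apply: eq_bigr => j _; rewrite !mxE.
Qed.

Lemma fmx_adj (I J : finType) (A : I -> J -> C) :
  adjmx (fmx A) = fmx (fun x y => (A y x)^*).
Proof. by apply/matrixP => i j; rewrite !mxE. Qed.

Lemma fmx_trace (I : finType) (A : I -> I -> C) : \tr (fmx A) = \sum_x A x x.
Proof.
by rewrite -[RHS]sum_enum_val; apply: eq_bigr => i _; rewrite mxE.
Qed.

Lemma fmx_contraction (I J : finType) (A : I -> J -> C) :
  (forall v : J -> C,
     \sum_x `|\sum_y A x y * v y| ^+ 2 <= \sum_y `|v y| ^+ 2) ->
  contraction (fmx A).
Proof.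
move=> h v; have := h (fun y => v (enum_rank y) 0).
have -> : \sum_y `|v (enum_rank y) 0| ^+ 2 = normsq v.
  rewrite normsqE -[LHS]sum_enum_val; apply: eq_bigr => i _.
  by rewrite big_ord1 enum_valK.
congr (_ <= _); rewrite normsqE -[LHS]sum_enum_val; apply: eq_bigr => i _.
rewrite big_ord1 mxE -[X in `|X| ^+ 2]sum_enum_val; congr (`|_| ^+ 2).
by apply: eq_bigr => j _; rewrite mxE enum_valK.
Qed.

End FinTypeMatrices.

Section Gates.
Variable N : nat.
Implicit Types (x y : bits N) (v : bits N -> Cx).

Definition flip (i : 'I_N) (x : bits N) : bits N :=
  [ffun k => if k == i then ~~ x k else x k].

Lemma flipK i : involutive (flip i).
Proof.
by move=> x; apply/ffunP => k; rewrite !ffunE; case: eqP => // _; rewrite negbK.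
Qed.

Lemma flip_neq i x : flip i x != x.
Proof. by apply/eqP => /ffunP/(_ i); rewrite ffunE eqxx; case: (x i). Qed.

Lemma agree_off1 i x y : agree_off (pred1 i) x y = (y == x) || (y == flip i x).
Proof.
apply/forallP/orP => [h|[/eqP-> k|/eqP-> k]].
- have [e|ne] := eqVneq (y i) (x i); [left|right]; apply/eqP/ffunP => k.
    have := h k; rewrite inE; case: eqP => [->//|_ /=]; by move/eqP.
  rewrite ffunE; have := h k; rewrite inE; case: eqP => [->_|_ /= /eqP//].
  by move: ne; case: (y i); case: (x i).
- by rewrite eqxx implybT.
- by rewrite inE ffunE; case: (k == i); rewrite /= ?eqxx.
Qed.

Lemma sum_agree_off1 i x (F : bits N -> Cx) :
  \sum_y (if agree_off (pred1 i) x y then F y else 0) = F x + F (flip i x).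
Proof.
rewrite (bigD1 x) // (bigD1 (flip i x)) ?flip_neq //= !agree_off1 !eqxx orbT /=.
rewrite big1 ?addr0 // => y /andP[y1 y2].
by rewrite agree_off1 (negPf y1) (negPf y2).
Qed.

Lemma invsqrt2_conj : invsqrt2^* = invsqrt2.
Proof. by apply: conj_Creal; rewrite complex_real. Qed.

Lemma invsqrt2_sqr : invsqrt2 * invsqrt2 * 2 = 1.
Proof.
have n2 : 2 != 0 :> Cx by rewrite pnatr_eq0.
rewrite -[RHS](mulVf n2); congr (_ * _).
rewrite /invsqrt2 -rmorphM -invfM -expr2 sqr_sqrtr ?ler0n //.
by rewrite fmorphV rmorph_nat.
Qed.

Lemma omega8_norm : `|omega8| = 1.
Proof.
rewrite normc_def /= exprVn sqr_sqrtr ?ler0n // [X in Num.sqrt X](_ : _ = 1) ?sqrtr1 //.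
by field.
Qed.

(** On each pair [x], [flip i x] the gate is a 2 x 2 Hadamard matrix, which preserves the sum of
    squared moduli. Doubling the sum forms the pairs without choosing representatives. *)
Lemma GH_contraction i : contraction (fmx (gate_op (GH i : gate N))).
Proof.
apply: fmx_contraction => v.
have E x : \sum_y gate_op (GH i : gate N) x y * v y =
    H1 (x i) (x i) * v x + H1 (x i) (~~ x i) * v (flip i x).
  rewrite -[X in _ + X](_ : H1 (x i) (flip i x i) * v (flip i x) = _); last first.
    by rewrite ffunE eqxx.
  rewrite -(sum_agree_off1 i x (fun y => H1 (x i) (y i) * v y)).
  by apply: eq_bigr => y _ /=; case: ifP; rewrite ?mul0r.
under eq_bigr => x _ do rewrite E.
have double (F : bits N -> Cx) : (\sum_x F x) *+ 2 = \sum_x (F x + F (flip i x)).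
  by rewrite big_split /= mulr2n; congr (_ + _); apply: (reindex_inj (inv_inj (flipK i))).
rewrite -(ler_pMn2r (n := 2)) // !double; apply: ler_sum => x _; rewrite flipK.
have -> : flip i x i = ~~ x i by rewrite ffunE eqxx.
rewrite le_eqVlt; apply/orP; left; apply/eqP.
rewrite !normCK !(rmorphD, rmorphM) /= /H1.
move: invsqrt2_sqr; case: (x i) => /= s2; rewrite ?rmorphN /= ?invsqrt2_conj.
  by rewrite -[RHS]mul1r -s2; ring.
by rewrite -[RHS]mul1r -s2; ring.
Qed.

Lemma GT_contraction i : contraction (fmx (gate_op (GT i : gate N))).
Proof.
apply: fmx_contraction => v; apply: ler_sum => x _.
have -> : \sum_y gate_op (GT i : gate N) x y * v y = T1 (x i) (x i) * v x.
  rewrite -[RHS]addr0.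
  rewrite -[X in _ + X](_ : T1 (x i) (flip i x i) * v (flip i x) = _); last first.
    by rewrite ffunE eqxx /T1; case: (x i); rewrite mul0r.
  rewrite -(sum_agree_off1 i x (fun y => T1 (x i) (y i) * v y)).
  by apply: eq_bigr => y _ /=; case: ifP; rewrite ?mul0r.
rewrite /T1 eqxx normrM; case: (x i); by rewrite ?omega8_norm ?normr1 mul1r.
Qed.

Definition cnot (c t : 'I_N) (x : bits N) : bits N :=
  [ffun k => if k == t then x k (+) x c else x k].

(** The gate permutes the basis: row [x] has its only 1 at [f x] with [f] injective. For [c = t] the
    gate is the identity, hence the case split. *)
Lemma GCNOT_contraction c t : contraction (fmx (gate_op (GCNOT c t : gate N))).
Proof.
apply: fmx_contraction => v.
have [f fi E] : exists2 f : bits N -> bits N, injective f &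
    forall x y, gate_op (GCNOT c t : gate N) x y = if y == f x then 1 else 0.
  have [ct|ct] := eqVneq c t.
    by exists id => // x y; rewrite /= ct eqxx eq_sym.
  exists (cnot c t).
    apply: inv_inj => x; apply/ffunP => k; rewrite !ffunE (negPf ct).
    by case: eqP => // ->; rewrite addbK.
  move=> x y; rewrite /= (negPf ct); congr (if _ then _ else _).
  apply/idP/eqP => [/andP[/andP[/forallP h /eqP xc] /eqP xt]|->].
    apply/ffunP => k; rewrite ffunE; case: eqP => [->|/eqP kt].
      by rewrite xt xc addbK.
    have [->//|kc] := eqVneq k c.
    by have := h k; rewrite !inE (negPf kt) (negPf kc) /= => /eqP.
  rewrite !ffunE eqxx (negPf ct) eqxx addbK eqxx !andbT.
  apply/forallP => k; rewrite !inE ffunE; case: (k == t); rewrite ?orbT //=.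
  by rewrite eqxx implybT.
rewrite le_eqVlt; apply/orP; left; apply/eqP; rewrite [RHS](reindex_inj fi).
apply: eq_bigr => x _; congr (`|_| ^+ 2).
rewrite (eq_bigr (fun y => (if y == f x then 1 else 0) * v y)) => [|y _]; last by rewrite E.
rewrite (bigD1 (f x)) //= eqxx mul1r big1 ?addr0 // => y ne.
by rewrite (negPf ne) mul0r.
Qed.

Lemma gate_contraction (g : gate N) : contraction (fmx (gate_op g)).
Proof.
case: g => [i|i|c t]; [exact: GH_contraction|exact: GT_contraction|exact: GCNOT_contraction].
Qed.

Definition circuit_mx (C : seq (gate N)) : 'M[Cx]_#|bits N| :=
  foldl (fun U g => fmx (gate_op g) *m U) 1%:M C.

Lemma circuit_contraction C : contraction (circuit_mx C).
Proof.
rewrite /circuit_mx; have := @contraction1 Cx #|bits N|.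
elim: C 1%:M => //= g C IH U cU; apply: IH.
by apply: contractionM cU; apply: gate_contraction.
Qed.

Lemma fmx_run_circuit C (rho : Op N) :
  fmx (run_circuit C rho) = circuit_mx C *m fmx rho *m adjmx (circuit_mx C).
Proof.
rewrite /circuit_mx.
(* Generalized over the product [U] of the gates already applied, because [foldl] accumulates from
   the left. *)
suff h (U : 'M[Cx]_#|bits N|) (r s : Op N) : fmx r = U *m fmx s *m adjmx U ->
   fmx (run_circuit C r) = foldl (fun U g => fmx (gate_op g) *m U) U C *m fmx s
      *m adjmx (foldl (fun U g => fmx (gate_op g) *m U) U C).
  apply: h; rewrite mul1mx (_ : adjmx 1%:M = 1%:M) ?mulmx1 //.
  by apply/matrixP => i j; rewrite adjmxE !mxE eq_sym conjC_nat.
elim: C U r s => [//|g C IH] U r s e.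
have h : fmx (opmul (opmul (gate_op g) r) (adjoint (gate_op g))) =
    (fmx (gate_op g) *m U) *m fmx s *m adjmx (fmx (gate_op g) *m U).
  rewrite adjmxM (_ : fmx (opmul _ _) = fmx (gate_op g) *m fmx r *m adjmx (fmx (gate_op g))).
    by rewrite e !mulmxA.
  by rewrite fmx_adj !fmxM.
exact: IH h.
Qed.

End Gates.

(** * Acceptance probability as a trace over the advice register *)

Section Acceptance.
Variables a n m : nat.
Implicit Types (x y : bits (total_qubits a n m)).

Definition work_zero x := [forall i, ~~ wrk_part x i].

(* The isometry [|s> |-> |s>|z>|0...0>] loading the input [z]. *)
Definition load_input (z : bits n) : 'M[Cx]_(#|bits (total_qubits a n m)|, #|bits a|) :=
  fmx (fun x s => if (adv_part x == s) && (inp_part x == z) && work_zero x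
                  then 1 else 0).

Definition output_proj : 'M[Cx]_#|bits (total_qubits a n m)| :=
  fmx (fun x y => if (x == y) && x (out_qubit a n m) then 1 else 0).

(** The measurement operator [X_z] on the advice: load [z], run the circuit, project on output 1,
    and pull back. *)
Definition acceptance_op (C : seq (gate (total_qubits a n m))) (z : bits n) :
  'M[Cx]_#|bits a| :=
  adjmx (circuit_mx C *m load_input z) *m output_proj *m (circuit_mx C *m load_input z).

Lemma parts_inj x y : adv_part x = adv_part y -> inp_part x = inp_part y ->
  work_zero x -> work_zero y -> x = y.
Proof.
move=> ea ei /forallP wx /forallP wy; apply/ffunP => k.
rewrite -(splitK k); case: (split k) => [i|j] /=.
  by move/ffunP/(_ i): ea; rewrite !ffunE.
rewrite -(splitK j); case: (split j) => [i|i] /=.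
  by move/ffunP/(_ i): ei; rewrite !ffunE.
by have := wx i; have := wy i; rewrite !ffunE => /negPf-> /negPf->.
Qed.

(** Group the basis strings by advice part; by [parts_inj] each group has at most one string with
    input [z] and zero work qubits. *)
Lemma load_input_contraction z : contraction (load_input z).
Proof.
apply: fmx_contraction => v.
pose P x := (inp_part x == z) && work_zero x.
have E x : \sum_s (if (adv_part x == s) && (inp_part x == z) && work_zero x
     then 1 else 0) * v s = if P x then v (adv_part x) else 0.
  rewrite (bigD1 (adv_part x)) //= eqxx -/(P x) big1 => [|s]; last first.
    by rewrite eq_sym => /negPf->; rewrite mul0r.
  by case: (P x); rewrite ?mul1r ?mul0r addr0.
under eq_bigr => x _ do rewrite E.
rewrite (partition_big (@adv_part a n m) predT) //=; apply: ler_sum => s _.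
have [/existsP[x /andP[/eqP ax Px]]|/existsPn no] :=
  boolP [exists x, (adv_part x == s) && P x].
  rewrite (bigD1 x) /= ?ax // Px big1 ?addr0 // => y /andP[/eqP ay ne].
  case: ifP => [/andP[/eqP iy wy]|]; last by rewrite normr0 expr0n.
  case/andP: Px => /eqP ix wx; case/eqP: ne.
  by apply: parts_inj; rewrite ?ay ?iy.
rewrite big1 ?exprn_ge0 // => y /eqP ay.
by case: ifP => Py; [have := no y; rewrite ay eqxx Py|rewrite normr0 expr0n].
Qed.

Lemma output_proj_contraction : contraction output_proj.
Proof.
apply: fmx_contraction => v; apply: ler_sum => x _.
rewrite (bigD1 x) //= eqxx big1 => [|y]; last first.
  by rewrite eq_sym => /negPf->; rewrite mul0r.
rewrite addr0 normrM exprMn; case: ifP => _.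
  by rewrite normr1 expr1n mul1r.
by rewrite normr0 expr0n mul0r exprn_ge0.
Qed.

Lemma acceptance_op_contraction C z : contraction (acceptance_op C z).
Proof.
have cV : contraction (circuit_mx C *m load_input z).
  by apply: contractionM; [apply: circuit_contraction|apply: load_input_contraction].
apply: contractionM cV; apply: contractionM (output_proj_contraction).
by apply: contraction_adj; apply: contractionM;
  [apply: circuit_contraction|apply: load_input_contraction].
Qed.

Lemma acceptance_op_hermitian C z : hermitian (acceptance_op C z).
Proof.
rewrite /hermitian /acceptance_op !adjmxM !adjmxK !mulmxA.
rewrite (_ : adjmx output_proj = output_proj) ?mulmxA //.
apply/matrixP => i j; rewrite adjmxE !mxE [enum_val j == _]eq_sym.
case: eqP => [->|_] /=; last by rewrite conjC0.
by case: ifP; rewrite ?conjC0 ?conjC1.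
Qed.

Lemma load_input_conj z (rho : Op a) :
  load_input z *m fmx rho *m adjmx (load_input z) =
  fmx (fun x y => if [&& inp_part x == z, work_zero x, inp_part y == z & work_zero y]
                  then rho (adv_part x) (adv_part y) else 0).
Proof.
rewrite fmx_adj !fmxM; congr fmx.
apply: functional_extensionality => x; apply: functional_extensionality => y.
under eq_bigr => s _.
  rewrite (bigD1 (adv_part x)) //= eqxx big1 => [|r]; last first.
    by rewrite eq_sym => /negPf->; rewrite mul0r.
  rewrite addr0; over.
rewrite (bigD1 (adv_part y)) //= eqxx big1 => [|s]; last first.
  by rewrite eq_sym => /negPf->; rewrite conjC0 mulr0.
rewrite !addr0 /=; case: (inp_part x == z) => /=; last by rewrite !mul0r.
case: (work_zero x) => /=; last by rewrite !mul0r.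
by case: ifP; rewrite ?conjC0 ?conjC1 ?mul1r ?mulr1 ?mulr0.
Qed.

(** A diagonal [xi] is a classical mixture of basis inputs, so the initial state is the matching
    mixture of loaded states. *)
Lemma fmx_initial_state (rho : Op a) (xi : Op n) :
  (forall z w, z != w -> xi z w = 0) ->
  fmx (@initial_state a n m rho xi) =
  \sum_z xi z z *: (load_input z *m fmx rho *m adjmx (load_input z)).
Proof.
move=> dxi; under eq_bigr => z _ do rewrite load_input_conj.
apply/matrixP => i j; rewrite summxE mxE.
under eq_bigr => z _ do rewrite !mxE.
move: (enum_val i) (enum_val j) => x y;
rewrite /initial_state -/(work_zero x) -/(work_zero y).
rewrite (bigD1 (inp_part x)) //= eqxx big1 ?addr0 => [|z]; last first.
  by rewrite eq_sym => /negPf->; rewrite mulr0.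
have [e|ne] := eqVneq (inp_part y) (inp_part x); last first.
  by rewrite dxi 1?eq_sym // mulr0 !mul0r /= andbF mulr0.
rewrite e; case: (work_zero x); case: (work_zero y); rewrite /= ?mulr0 ?mulr1 //.
by rewrite mulrC.
Qed.

(** Heisenberg picture: cyclicity of the trace moves loading and circuit from the state to the
    measurement. *)
Lemma accept_probE C (rho : Op a) (xi : Op n) :
  (forall z w, z != w -> xi z w = 0) ->
  accept_prob C rho xi =
  complex.Re (\sum_z xi z z * \tr (acceptance_op C z *m fmx rho)).
Proof.
move=> dxi; rewrite /accept_prob; congr (complex.Re _).
transitivity (\tr (output_proj *m fmx (run_circuit C (@initial_state a n m rho xi)))).
  rewrite fmxM fmx_trace big_mkcond; apply: eq_bigr => x _.
  rewrite (bigD1 x) //= eqxx big1 => [|y]; last first.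
    by rewrite eq_sym => /negPf->; rewrite mul0r.
  by rewrite addr0; case: ifP; rewrite ?mul1r ?mul0r.
rewrite fmx_run_circuit fmx_initial_state // mulmx_sumr mulmx_suml mulmx_sumr raddf_sum.
apply: eq_bigr => z _ /=; rewrite -scalemxAr -scalemxAl -scalemxAr mxtraceZ; congr (_ * _).
by rewrite /acceptance_op !adjmxM !mulmxA mxtrace_mulC !mulmxA mxtrace_mulC !mulmxA.
Qed.

End Acceptance.

(** * The two states *)

Lemma card_bits n : #|{: bits n}| = (2 ^ n)%N.
Proof. by rewrite card_ffun card_bool card_ord. Qed.

Section Densities.
Variables (n : nat) (rho : Op n).

Lemma psd_fmx : psd rho -> psdmx (fmx rho).
Proof.
move=> pr v; have := pr (fun x => v (enum_rank x) 0); congr (_ <= _).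
rewrite -[LHS]sum_enum_val /mxtrace big_ord1 mxE.
under [RHS]eq_bigr => j _ do rewrite mxE mulr_suml.
rewrite [RHS]exchange_big; apply: eq_bigr => i _ /=; rewrite -[LHS]sum_enum_val.
by apply: eq_bigr => j _; rewrite !mxE !enum_valK.
Qed.

End Densities.

Section States.
Variable k : nat.

Definition cons_bit (c : bool) (t : bits k) : bits k.+1 :=
  [ffun i => if unlift ord0 i is Some j then t j else c].

Definition tail_bits (x : bits k.+1) : bits k := [ffun j => x (lift ord0 j)].

Lemma cons_bit0 c t : cons_bit c t ord0 = c.
Proof. by rewrite ffunE unlift_none. Qed.

Lemma tail_cons_bit c t : tail_bits (cons_bit c t) = t.
Proof. by apply/ffunP => j; rewrite !ffunE liftK. Qed.

Lemma cons_tail_bits (x : bits k.+1) : cons_bit (x ord0) (tail_bits x) = x.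
Proof. by apply/ffunP => i; rewrite ffunE; case: unliftP => [j|] -> //; rewrite ffunE. Qed.

Lemma sum_cons_bit (V : nmodType) (F : bits k.+1 -> V) :
  \sum_x F x = \sum_t (F (cons_bit false t) + F (cons_bit true t)).
Proof.
rewrite (reindex (fun p : bool * bits k => cons_bit p.1 p.2)) /=; last first.
  exists (fun x : bits k.+1 => (x ord0, tail_bits x)) => [[c t] _|x _] /=.
    by rewrite cons_bit0 tail_cons_bit.
  by rewrite cons_tail_bits.
rewrite -(pair_bigA _ (fun c t => F (cons_bit c t))) /= exchange_big /=.
by apply: eq_bigr => t _; rewrite big_bool addrC.
Qed.

Variable e : {ffun bits k -> bool}.

Definition efi_state (b : bool) : Op k.+1 :=
  fun x y => if (x == y) && (x ord0 == e (tail_bits x) (+) b) then 2 ^- k else 0.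

Lemma efi_state_diag b z w : z != w -> efi_state b z w = 0.
Proof. by rewrite /efi_state => /negPf->. Qed.

Lemma expV2_ge0 : 0 <= 2 ^- k :> Cx.
Proof. by rewrite invr_ge0 exprn_ge0 ?ler0n. Qed.

Lemma efi_state_density b : density (efi_state b).
Proof.
split.
  move=> v; apply: sumr_ge0 => x _; rewrite (bigD1 x) //= big1 ?addr0 => [|y ne]; last first.
    by rewrite efi_state_diag 1?eq_sym // mulr0 mul0r.
  rewrite mulrAC mulr_ge0 // -?normCKC ?exprn_ge0 //.
  by rewrite /efi_state; case: ifP => // _; apply: expV2_ge0.
have k0 : 2 ^+ k != 0 :> Cx by rewrite expf_neq0 ?pnatr_eq0.
rewrite /trace sum_cons_bit -[RHS](mulfV k0).
rewrite -[X in X / _]natrX -card_bits mulr_natl -sumr_const.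
apply: eq_bigr => t _; rewrite /efi_state !eqxx !cons_bit0 !tail_cons_bit.
by case: (e t); case: b; rewrite /= ?addr0 ?add0r.
Qed.

Lemma efi_state_trace_distance :
  is_trace_distance (efi_state false) (efi_state true) (1 - 0).
Proof.
have c2 : (2 ^- k : Cx)^* = 2 ^- k by apply/CrealP; rewrite ger0_real ?expV2_ge0.
(* The states are diagonal with disjoint supports, so the absolute value of their difference is
   their sum, [2^-k] times the identity, of trace 2. *)
exists (opadd (efi_state false) (efi_state true)).
have E x y : opadd (efi_state false) (efi_state true) x y = if x == y then 2 ^- k else 0.
  rewrite /opadd /efi_state; case: (x == y); last by rewrite /= addr0.
  by rewrite /= addbT addbF; case: (x ord0); case: (e _); rewrite /= ?addr0 ?add0r.
split; last split.
- move=> v; rewrite (eq_bigr (fun x => \sum_y (v x)^* * efi_state false x y * v y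
      + \sum_y (v x)^* * efi_state true x y * v y)) => [|x _]; last first.
    by rewrite -big_split; apply: eq_bigr => y _; rewrite /opadd mulrDr mulrDl.
  by rewrite big_split addr_ge0 //;
    [have [] := efi_state_density false|have [] := efi_state_density true].
- apply: functional_extensionality => x; apply: functional_extensionality => y.
  rewrite /opmul; apply: eq_bigr => z _; rewrite !E /adjoint /opsub /efi_state.
  rewrite [z == x]eq_sym; have [<-|ne] := eqVneq x z; last first.
    by rewrite /= subr0 conjC0 !mul0r.
  have [_|ne] := eqVneq x y; last by rewrite /= subr0 !mulr0.
  rewrite /= addbT addbF.
  by case: (x ord0); case: (e _); rewrite /= ?subr0 ?sub0r ?rmorphN /= c2 ?mulrNN.
rewrite /trace; under eq_bigr => x _ do rewrite E eqxx.
rewrite sumr_const card_bits subr0 mulr1 rmorph_nat.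
by rewrite -[LHS]mulr_natr natrX exprSr mulrA mulVf ?mul1r // expf_neq0 ?pnatr_eq0.
Qed.

Lemma signed_difference (s : bool) (c X Y : Cx) :
  (if true && (false == s (+) false) then c else 0) * X -
  (if true && (false == s (+) true) then c else 0) * X +
  ((if true && (true == s (+) false) then c else 0) * Y -
   (if true && (true == s (+) true) then c else 0) * Y) =
  2 * c * ((-1) ^+ s * (2^-1 * (X - Y))).
Proof.
have h : 2 * 2^-1 = 1 :> Cx by rewrite mulfV ?pnatr_eq0.
transitivity (2 * 2^-1 * c * ((-1) ^+ s * (X - Y))); last by ring.
by rewrite h; case: s; rewrite /= ?expr0 ?expr1; ring.
Qed.

Definition difference_op a m (C : seq (gate (total_qubits a k.+1 m))) (t : bits k) :=
  2^-1 *: (acceptance_op C (cons_bit false t) - acceptance_op C (cons_bit true t)).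

(** Pair the two strings with tail [t]: each state contains exactly one of them, and [e t] decides
    which, giving the sign in front of [Y_t]. *)
Lemma efi_advantage a m (C : seq (gate (total_qubits a k.+1 m))) (rho : Op a) :
  accept_prob C rho (efi_state false) - accept_prob C rho (efi_state true) =
  complex.Re (2 * 2 ^- k * \tr (signed_sum e (difference_op C) *m fmx rho)).
Proof.
rewrite !accept_probE; try exact: efi_state_diag.
rewrite -raddfB; congr (complex.Re _).
rewrite -sumrB sum_cons_bit /signed_sum mulmx_suml raddf_sum mulr_sumr.
apply: eq_bigr => t _ /=.
rewrite /difference_op -!scalemxAl !mxtraceZ mulmxBl raddfB /=.
rewrite /efi_state !eqxx !cons_bit0 !tail_cons_bit.
exact: signed_difference.
Qed.

End States.

(** * Counting circuits and choosing the signs *)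

Section Codes.
Variable L : nat.

(* A code for a gate on an unknown number [N <= L] of qubits. *)
Definition gate_code := option ('I_3 * 'I_L * 'I_L)%type.

(** Partial, so that one finite type of codes serves every register size; codes that decode to
    nothing are skipped and thus act as padding. *)
Definition decode_gate N (g : gate_code) : option (gate N) :=
  if g is Some (tag, i, j) then
    if (insub (val i), insub (val j)) is (Some i', Some j') then
      Some (match val tag with 0 => GH i' | 1 => GT i' | _ => GCNOT i' j' end)%N
    else None
  else None.

Definition decode_circuit N (s : seq gate_code) : seq (gate N) :=
  pmap (decode_gate N) s.

Lemma decode_gate_surj N (g : gate N) : (N <= L)%N ->
  exists c, decode_gate N c = Some g.
Proof.
move=> NL; pose w (i : 'I_N) : 'I_L := widen_ord NL i.
have wK (i : 'I_N) : insub (val (w i)) = Some i by rewrite /= valK.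
case: g => [i|i|i j].
- by exists (Some (@inord 2 0, w i, w i)); rewrite /decode_gate !wK /= inordK.
- by exists (Some (@inord 2 1, w i, w i)); rewrite /decode_gate !wK /= inordK.
- by exists (Some (@inord 2 2, w i, w j)); rewrite /decode_gate !wK /= inordK.
Qed.

Lemma decode_circuit_surj N S (C : seq (gate N)) : (N <= L)%N -> (size C <= S)%N ->
  exists s : S.-tuple gate_code, decode_circuit N s = C.
Proof.
move=> NL; elim: C S => [|g C IH] [|S] //= sC.
- by exists [tuple].
(* The empty circuit is coded by padding alone. *)
- by exists (nseq_tuple S.+1 None); rewrite /decode_circuit /=; elim: S {sC}.
have [s es] := IH S sC; have [c ec] := decode_gate_surj g NL.
by exists [tuple of c :: s]; rewrite /decode_circuit /= ec /= -es.
Qed.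

Lemma card_gate_code : #|{: gate_code}| = (3 * L * L).+1.
Proof. by rewrite card_option !card_prod !card_ord. Qed.

End Codes.

(** On the left: advice sizes, work sizes, gate sequences of length [2^lam], and the largest advice
    dimension. The exponents of 2 add up to order [lam * 2^lam], below [16 * 4^lam]. *)
Lemma code_count_bound lam :
  ((2 ^ lam).+1 * (2 ^ lam).+1 *
   (3 * (2 ^ lam + (6 * lam + 13)) * (2 ^ lam + (6 * lam + 13))).+1 ^ (2 ^ lam) *
   2 ^ (2 ^ lam) <= 2 ^ (2 ^ (2 * lam + 4)))%N.
Proof.
have lt : (lam < 2 ^ lam)%N by rewrite ltn_expl.
have hL : (2 ^ lam + (6 * lam + 13) <= 2 ^ (lam + 4))%N by rewrite expnD; lia.
have hG : ((3 * (2 ^ lam + (6 * lam + 13)) * (2 ^ lam + (6 * lam + 13))).+1 <=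
     2 ^ (2 * lam + 10))%N.
  have -> : (2 ^ (2 * lam + 10) = 4 * (2 ^ (lam + 4) * 2 ^ (lam + 4)))%N.
    by rewrite -expnD -[4%N]/(2 ^ 2)%N -expnD; congr (2 ^ _)%N; lia.
  have := leq_mul hL hL; have : (0 < 2 ^ (lam + 4))%N by rewrite expn_gt0.
  move: (2 ^ (lam + 4))%N (2 ^ lam + (6 * lam + 13))%N => M L'; nia.
have hS : ((2 ^ lam).+1 <= 2 ^ (lam + 1))%N.
  by rewrite expnD expn1 muln2 -addnn -addn1 leq_add2l expn_gt0.
apply: (@leq_trans (2 ^ (lam + 1) * 2 ^ (lam + 1) *
    (2 ^ (2 * lam + 10)) ^ (2 ^ lam) * 2 ^ 2 ^ lam)%N).
  by rewrite !leq_mul // leq_exp2r // expn_gt0.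
rewrite -expnM -!expnD leq_exp2l //.
rewrite [X in (_ <= X)%N](_ : _ = 16 * (2 ^ lam * 2 ^ lam))%N; last first.
  by rewrite -expnD -[16%N]/(2 ^ 4)%N -expnD; congr (2 ^ _)%N; lia.
move: (2 ^ lam)%N lt => s; nia.
Qed.

Section HardSigns.
Variable lam : nat.
(** [L] bounds the register: [k + 1] input qubits, one output qubit, and at most [S] others. The
    squared advantage will be at most [8 q^2 / 2^k], and this [k] makes that exactly [4^-lam]. *)
Let k := (6 * lam + 11)%N.
Let S := (2 ^ lam)%N.
Let L := (S + (6 * lam + 13))%N.
Let q := (2 ^ (2 * lam + 4))%N.

Lemma exists_hard_signs : exists e : {ffun bits k -> bool},
  forall a m (C : seq (gate (total_qubits a k.+1 m))) (rho : Op a),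
  density rho -> (a + m + size C <= S)%N ->
  `|accept_prob C rho (efi_state e false) - accept_prob C rho (efi_state e true)|
     <= (2 ^ lam)%:R^-1.
Proof.
pose J := ('I_S.+1 * 'I_S.+1 * S.-tuple (gate_code L))%type.
pose circ (j : J) := @decode_circuit L (total_qubits j.1.1 k.+1 j.1.2) j.2.
pose Y (j : J) := difference_op (circ j).
have cY j t : contraction (Y j t).
  by apply: contraction_half_sub; apply: acceptance_op_contraction.
have hY j t : hermitian (Y j t).
  rewrite /hermitian adjmxZ adjmxB !acceptance_op_hermitian; congr (_ *: _).
  by apply: conj_Creal; rewrite ger0_real ?invr_ge0 ?ler0n.
have q0 : (0 < q)%N by rewrite expn_gt0.
have dD (j : J) : (#|{: bits j.1.1}| <= 2 ^ S)%N.
  by rewrite card_bits leq_exp2l // -ltnS.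
have [e he] := exists_signs q0 dD cY hY; exists e => a m C rho [/psd_fmx pr tr1] size_le.
have aS : (a < S.+1)%N by lia.
have mS : (m < S.+1)%N by lia.
have NL : (total_qubits a k.+1 m <= L)%N by rewrite /total_qubits /L /k; lia.
have sC : (size C <= S)%N by lia.
have [s es] := decode_circuit_surj (C := C) NL sC.
have {he} := he (Ordinal aS, Ordinal mS, s); rewrite /Y /circ /= es.
set Z := signed_sum _ _ => hZ.
have hermZ : hermitian Z.
  apply: hermitian_sumZ => t; first by rewrite rpredX // rpredN rpred1.
  by have := hY (Ordinal aS, Ordinal mS, s) t; rewrite /Y /circ /= es.
have tr1' : \tr (fmx rho) = 1 by rewrite fmx_trace.
have zr := trace_density_real pr hermZ.
(* Number of codes times dimension is absorbed into [2^q], so everything is now a [q]-th power. *)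
have {hZ} hZ : \tr (Z ^+ (2 * q)) <= (2 ^ q * (#|{: bits k}| ^ q * q ^ (2 * q)))%:R.
  apply: le_trans hZ _; rewrite ler_nat leq_mul2r.
  rewrite !card_prod card_tuple card_gate_code !card_ord.
  by rewrite (code_count_bound lam) orbT.
have := trace_density_pow pr tr1' (2 * lam + 4) hermZ.
rewrite efi_advantage -/Z expnS -/q => /le_trans/(_ hZ).
rewrite card_bits (expnM q) -!expnMn natrX exprM.
rewrite -(RRe_real zr); move: (complex.Re (\tr (Z *m fmx rho))) => x.
(* Taking [q]-th roots leaves a bound on [x^2]. *)
rewrite ler_pXn2r ?nnegrE ?ler0n // -?realEsqr ?RRe_real // => [h|]; last first.
  by apply/complex_realP; exists x.
have {h} h : x ^+ 2 <= (2 * (2 ^ k * q ^ 2))%:R.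
  by rewrite -lecR rmorphXn rmorph_nat.
have -> : complex.Re (2 * 2 ^- k * x%:C%C) = 2 * 2 ^- k * x.
  have -> : 2 * 2 ^- k * x%:C%C = ((2 * 2 ^- k * x)%:C)%C :> Cx.
    by rewrite !rmorphM /= fmorphV rmorphXn /= !rmorph_nat.
  by [].
rewrite -(@ler_pXn2r _ 2) ?nnegrE ?invr_ge0 ?ler0n // real_normK ?num_real //.
rewrite exprMn; apply: le_trans (ler_wpM2l (sqr_ge0 _) h) _.
have e2 : (q ^ 2 = 2 ^ lam * 2 ^ lam * 2 ^ lam * 2 ^ lam * 2 ^ 8)%N.
  by rewrite -expnM -!expnD; congr (2 ^ _)%N; lia.
have ek : (2 ^ k = 2 ^ lam * 2 ^ lam * 2 ^ lam * 2 ^ lam * 2 ^ lam * 2 ^ lam * 2 ^ 11)%N.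
  by rewrite -!expnD; congr (2 ^ _)%N; rewrite /k; lia.
have -> : (2 ^+ k : Real) = (2 ^ k)%:R by rewrite natrX.
rewrite e2 ek; have : ((2 ^ lam)%:R : Real) != 0 by rewrite pnatr_eq0 expn_eq0.
rewrite !natrM; move: ((2 ^ lam)%:R : Real) => y y0.
rewrite le_eqVlt; apply/orP; left; apply/eqP; by field.
Qed.
End HardSigns.

(** * Polynomial against exponential growth, and the final construction *)

Lemma poly_le_exp c : exists N, forall lam, (N <= lam)%N -> (lam ^ c + c <= 2 ^ lam)%N.
Proof.
pose M := (c.+1 ^ c.+1)%N; exists (maxn (2 * M) c.+1) => lam; rewrite geq_max => /andP[h1 h2].
have M0 : (0 < M)%N by rewrite expn_gt0.
(* Raise [lam <= (c+1) 2^(lam / (c+1))] to the power [c+1]; the spare factor [lam] then absorbs [M]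
   as soon as [lam >= 2 M]. *)
have h3 : (lam ^ c.+1 <= M * 2 ^ lam)%N.
  set u := (lam %/ c.+1)%N.
  have lu : (lam <= c.+1 * 2 ^ u)%N.
    apply: (@leq_trans (c.+1 * u.+1)); last by rewrite leq_mul2l ltn_expl.
    by rewrite mulnC ltnW // ltn_ceil.
  apply: leq_trans (_ : (c.+1 * 2 ^ u) ^ c.+1 <= _)%N; first by rewrite leq_exp2r.
  by rewrite expnMn leq_mul2l -expnM leq_exp2l // leq_divM orbT.
have h4 : (2 * lam ^ c <= 2 ^ lam)%N.
  rewrite -(leq_pmul2l M0); apply: leq_trans h3; rewrite expnS mulnA [(M * 2)%N]mulnC.
  by rewrite leq_mul2r h1 orbT.
have h5 : (2 * c <= 2 ^ lam)%N.
  apply: (@leq_trans (2 ^ c.+1)); last by rewrite leq_exp2l.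
  by rewrite expnS leq_mul2l ltnW ?orbT // ltn_expl.
lia.
Qed.

Theorem theorem4p3 :
  exists (n : nat -> nat) (xi : forall lam : nat, bool -> Op (n lam)),
    [/\ poly_bounded n /\ (forall lam b, density (xi lam b)),
        (exists eps : nat -> Real, negligible eps /\
           forall lam, is_trace_distance (xi lam false) (xi lam true) (1 - eps lam))
      & (forall A : nu_qpt n, nu_qpt_valid A ->
           exists eps : nat -> Real, negligible eps /\
             forall lam, `|run_nu_qpt A (xi lam false) - run_nu_qpt A (xi lam true)|
                         <= eps lam)].
Proof.
(* Choice turns the good signs at each [lam] into a family; no efficiency is asked of the states. *)
pose sgn lam := constructive_indefinite_description _ (exists_hard_signs lam).
exists (fun lam => (6 * lam + 11).+1).
exists (fun lam => efi_state (proj1_sig (sgn lam))); split.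
- split; last by move=> lam b; apply: efi_state_density.
  (* The additive 20 covers [lam = 0] and [1], where the qubit counts are 12 and 18. *)
  exists 20 => -[|[|lam]] //.
  have : (2 ^ 3 <= lam.+2 ^ 19)%N.
    by apply: leq_trans (_ : 2 ^ 19 <= _)%N; rewrite ?leq_exp2r ?leq_exp2l.
  rewrite [(_ ^ 20)%N]expnS; move: (lam.+2 ^ 19)%N => x h; nia.
- exists (fun=> 0); split; last by move=> lam; apply: efi_state_trace_distance.
  by move=> c; exists 0%N => lam _; rewrite normr0 mul0r ler01.
move=> A [dens [c hc]].
(* The negligible function is the advantage itself, so only its decay for large [lam] needs
   proof. *)
eexists; split; last by move=> lam; apply: lexx.
move=> c'; have [N1 h1] := poly_le_exp c; have [N2 h2] := poly_le_exp c'.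
exists (maxn N1 N2) => lam; rewrite geq_max => /andP[/h1 l1 /h2 l2].
(* Past [N1] the distinguisher fits the size budget [2^lam], so its advantage is at most [2^-lam];
   past [N2] this beats [lam^c']. *)
have h := proj2_sig (sgn lam) _ _ (circuit A lam) _ (dens lam) (leq_trans (hc lam) l1).
rewrite normr_id.
apply: le_trans (_ : (2 ^ lam)%:R^-1 * (2 ^ lam)%:R <= _); last first.
  by rewrite mulVf // pnatr_eq0 expn_eq0.
apply: ler_pM => //; first by rewrite exprn_ge0 ?ler0n.
by rewrite -natrX ler_nat; apply: leq_trans l2; apply: leq_addr.
Qed.
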